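(* Let $g:\mathbb{Z}_{\ge1}\to\mathbb{N}$ be a normalised arithmetic function (i.e. $g(1)=1$) taking non-negative integer values, and let $k\in\mathbb{N}$. (a) If there exists an integer $\kappa\ge2$ such that $g(\kappa)\neq0$ and $g(m)=0$ for all $2\le m\le\kappa-1$, then there exists $n_0\in\mathbb{N}$ such that $(A_n^g(X))_n$ as well as $(P_n^g(X))_n$ are skewly log-concave at $k$ for all $n\ge n_0$. (b) If $g=e$, where $e(1)=1$ and $e(n)=0$ for $n\ge2$, then $(A_n^e(X))_n$ and $(P_n^e(X))_n$ are skewly log-concave everywhere, i.e. at every $k\in\mathbb{N}$ for every $n\ge k+1$.
   Context: $\mathbb{N}$ denotes the natural numbers including $0$. For $g:\mathbb{Z}_{\ge1}\to\mathbb{Z}$ with $g(1)=1$, the D'Arcais polynomials $P_n^g(X)\in\mathbb{Q}[X]$ are defined by the formal power series identity $$\sum_{n=0}^\infty P_n^g(X)q^n=\exp\left(X\sum_{n=1}^\infty g(n)\frac{q^n}{n}\right),$$ equivalently $P_0^g(X)=1$ and $P_n^g(X)=\frac{X}{n}\sum_{m=1}^n g(m)P_{n-m}^g(X)$ for $n\ge1$. Each $P_n^g$ has degree $n$. Put $A_n^g(X):=n!\,P_n^g(X)\in\mathbb{Z}[X]$. A sequence $(F_n(X))_{n\in\mathbb{N}}\subset\mathbb{R}[X]$ with $F_n(X)=\sum_k f_n(k)X^k$ is called skewly log-concave at $k\in\mathbb{N}$ for $n\in\mathbb{N}$ with $n\ge k+1$ if $$f_n(n-k)^2\ge f_{n+1}(n+1-k)\,f_{n-1}(n-1-k).$$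 *)

(* Defs.v *)
From mathcomp Require Import all_boot all_order all_algebra.

Set Implicit Arguments.
Unset Strict Implicit.
Unset Printing Implicit Defensive.

Import Order.TTheory GRing.Theory Num.Theory.

Local Open Scope ring_scope.

(* An arithmetic function on the positive integers is a function on [nat]
   whose value at 0 is never used. *)

(* The list [:: P_n; ...; P_0], so that its entry of index i is P_(n-i). *)
Fixpoint dArcais_seq (g : nat -> int) (n : nat) : seq {poly rat} :=
  if n is n'.+1 then
    let s := dArcais_seq g n' in
    (n'.+1%:R^-1 *: 'X * \sum_(i < n'.+1) (g i.+1)%:~R *: s`_i) :: s
  else [:: 1].

Definition dArcais (g : nat -> int) (n : nat) : {poly rat} :=
  head 0 (dArcais_seq g n).

(* n! P_n has integer coefficients; it is kept in Q[X] here. *)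
Definition dArcais_fact (g : nat -> int) (n : nat) : {poly rat} :=
  n`!%:R *: dArcais g n.

Lemma nth_dArcais_seq (g : nat -> int) (n i : nat) :
  (i <= n)%N -> (dArcais_seq g n)`_i = dArcais g (n - i).
Proof.
elim: n i => [|n IHn] [|i] // le_in.
by rewrite subSS -IHn.
Qed.

(* The defining recurrence; together these two lemmas characterize the
   sequence. *)
Lemma dArcais0 (g : nat -> int) : dArcais g 0 = 1.
Proof. by []. Qed.

Lemma dArcaisE (g : nat -> int) (n : nat) : (0 < n)%N ->
  dArcais g n =
    n%:R^-1 *: 'X * \sum_(1 <= m < n.+1) (g m)%:~R *: dArcais g (n - m).
Proof.
case: n => // n _; rewrite {1}/dArcais /=; congr (_ * _).
rewrite big_add1 /= big_mkord; apply: eq_bigr => i _.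
by rewrite nth_dArcais_seq ?subSS // -ltnS.
Qed.

(* The condition k < n makes all the truncated subtractions exact. *)
Definition skewly_log_concave (R : realDomainType) (F : nat -> {poly R})
    (k n : nat) : Prop :=
  (k < n)%N /\
  (F n.+1)`_(n.+1 - k) * (F n.-1)`_(n.-1 - k) <= (F n)`_(n - k) ^+ 2.

Definition arith_unit (n : nat) : nat := (n == 1)%N.

(* Main.v *)
(* Put c_k(j) = j! [X^j] P_(j+k). The recurrence for P_n becomes
     (j+1+k) c_k(j+1) = (j+1) (c_k(j) + g(2) c_(k-1)(j) + ... + g(k+1) c_0(j)),
   whence, by induction on k, c_k is a polynomial in j. Skew log-concavity of
   A_n at k, with n = j + k, reads
     j (n+1) c_k(j+1) c_k(j-1) <= (j+1) n c_k(j)^2;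
   if c_k has degree d and leading coefficient a <> 0, the difference of the two
   sides is a polynomial in j of degree at most 2d, whose coefficient of j^(2d)
   is (k + d) a^2. For k = 0 there is equality, since c_0 = 1. The condition for
   P_n follows from the one for A_n because c_k >= 0. *)
Require Import Defs.
From mathcomp Require Import all_boot all_order all_algebra.
From mathcomp Require Import ring lra zify.

Import Order.TTheory GRing.Theory Num.Theory.

Local Open Scope ring_scope.

(** * Degrees and top coefficients of products and of shift differences *)

Section Shift.
Set Implicit Arguments.
Unset Strict Implicit.
Variable R : idomainType.
Implicit Types (p q : {poly R}) (c : R).

Lemma size_mul_le p q m n :
  (size p <= m.+1)%N -> (size q <= n.+1)%N -> (size (p * q)%R <= (m + n).+1)%N.
Proof.
move=> hp hq; apply: leq_trans (size_polyMleq _ _) _.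
by lia.
Qed.

Lemma coef_mul_le p q m n :
  (size p <= m.+1)%N -> (size q <= n.+1)%N -> (p * q)`_(m + n) = p`_m * q`_n.
Proof.
move=> hp hq; rewrite coefM.
have hm : (m < (m + n).+1)%N by rewrite ltnS leq_addr.
rewrite (bigD1 (Ordinal hm)) //= addKn big1 ?addr0 // => i /eqP neq_i.
case: (ltngtP i m) => him.
- rewrite [q`__]nth_default ?mulr0 //; apply: leq_trans hq _.
  by rewrite -addnBAC ?(ltnW him) // -[n.+1]add1n leq_add2r subn_gt0.
- by rewrite nth_default ?mul0r //; apply: leq_trans hp _.
- by case: neq_i; apply: val_inj.
Qed.

Definition shift_diff c p := p \Po ('X + c%:P) - p.

Lemma shift_diffD c p q : shift_diff c (p + q) = shift_diff c p + shift_diff c q.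
Proof. by rewrite /shift_diff comp_polyD; ring. Qed.

(** Induction on the Horner form: the difference of p X + a is X times the difference of p, plus c
    times p(X + c), which is [p + shift_diff c p]. *)
Lemma size_shift_diff c p d : (size p <= d.+1)%N -> (size (shift_diff c p) <= d)%N.
Proof.
elim/poly_ind: p d => [|p a IH] d.
  by rewrite /shift_diff comp_poly0 subr0 size_poly0.
rewrite size_MXaddC; case: eqP => [->|_] /=.
  move=> _; rewrite /shift_diff mul0r add0r comp_polyC subrr size_poly0 //.
rewrite ltnS => hp.
have -> : shift_diff c (p * 'X + a%:P)
    = shift_diff c p * 'X + c *: (p + shift_diff c p).
  rewrite /shift_diff comp_polyD comp_polyM comp_polyX comp_polyC.
  by rewrite -mul_polyC; ring.
case: d hp => [|d] hp.
  move: hp; rewrite leqn0 size_poly_eq0 => /eqP ->.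
  by rewrite /shift_diff comp_poly0 subrr mul0r !addr0 scaler0 addr0 size_poly0.
apply: leq_trans (size_polyD _ _) _; rewrite geq_max; apply/andP; split.
  apply: leq_trans (size_polyMleq _ _) _.
  by rewrite size_polyX addn2 ltnS IH.
apply: leq_trans (size_scale_leq _ _) _.
apply: leq_trans (size_polyD _ _) _; rewrite geq_max hp /=.
by apply: leq_trans (IH d _) _ => //.
Qed.

(** To top order [shift_diff c] acts as c times the derivative. The factor ['X] brings the
    coefficient back to index d, so that d = 0 needs no separate statement. *)
Lemma coef_shift_diff c p d : (size p <= d.+1)%N ->
  ('X * shift_diff c p)`_d = c * d%:R * p`_d.
Proof.
elim/poly_ind: p d => [|p a IH] d.
  by rewrite /shift_diff comp_poly0 subr0 mulr0 !coef0 mulr0.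
rewrite size_MXaddC; case: eqP => [->|_] /=.
  move=> _; rewrite /shift_diff mul0r add0r comp_polyC subrr mulr0 coef0 coefC.
  by case: d => [|d] /=; ring.
rewrite ltnS => hp.
have -> : shift_diff c (p * 'X + a%:P)
    = shift_diff c p * 'X + c *: (p + shift_diff c p).
  rewrite /shift_diff comp_polyD comp_polyM comp_polyX comp_polyC.
  by rewrite -mul_polyC; ring.
case: d hp => [|d] hp; first by rewrite coefXM; ring.
rewrite coefXM /= coefD coefMX coefZ coefD [in RHS]coefD coefMX coefC /= addr0.
have := IH d hp; rewrite coefXM => hd.
have hs : (shift_diff c p)`_d = 0 by rewrite nth_default // size_shift_diff.
by rewrite hd hs -natr1; ring.
Qed.

Lemma size_X_shift_diff c p d :
  (size p <= d.+1)%N -> (size ('X * shift_diff c p)%R <= d.+1)%N.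
Proof.
move=> /(size_shift_diff c) hp; apply: leq_trans (size_polyMleq _ _) _.
by rewrite size_polyX.
Qed.

End Shift.

(** * Solving the shift recurrence, and signs of polynomials at large integers *)

Section Asymptotics.
Set Implicit Arguments.
Unset Strict Implicit.

(* On polynomials of degree at most d, the operator on the left maps the
   coefficient a of X^d to (d + k + 1) a, so it is bijective. *)
Lemma shift_equation_surj (R : numFieldType) (k : nat) (q : {poly R}) :
  exists p : {poly R},
    ('X + k.+2%:R%:P) * (p \Po ('X + 1%:P)) - ('X + 1%:P) * p = q.
Proof.
have [d] := ubnP (size q); elim: d q => // d IH q; rewrite ltnS => hq.
case: d IH hq => [|d] IH hq.
  exists 0; move: hq; rewrite leqn0 size_poly_eq0 => /eqP ->.
  by rewrite comp_poly0 !mulr0 subrr.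
pose T (p : {poly R}) : {poly R} := 'X * shift_diff 1 p + shift_diff 1 p
                     + k.+1%:R *: (p + shift_diff 1 p).
have TE p : ('X + k.+2%:R%:P) * (p \Po ('X + 1%:P)) - ('X + 1%:P) * p = T p.
  rewrite /T /shift_diff -mul_polyC -[k.+2%:R]natr1 polyCD; ring.
have TD p1 p2 : T (p1 + p2) = T p1 + T p2.
  by rewrite /T shift_diffD -!mul_polyC; ring.
(* The operator multiplies the coefficient of X^d by d + k + 1, so [T m] has the same coefficient
   there as q, and [q - T m] falls under the induction hypothesis. *)
pose m : {poly R} := (q`_d / (d + k.+1)%:R) *: 'X^d.
have hm : (size m <= d.+1)%N.
  by apply: leq_trans (size_scale_leq _ _) _; rewrite size_polyXn.
have hTm : (size (T m) <= d.+1)%N.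
  have hs := size_shift_diff 1 hm; have hX := size_X_shift_diff 1 hm.
  have hs' := leq_trans hs (leqnSn d).
  apply: leq_trans (size_polyD _ _) _; rewrite geq_max; apply/andP; split.
    by apply: leq_trans (size_polyD _ _) _; rewrite geq_max hX.
  apply: leq_trans (size_scale_leq _ _) _.
  by apply: leq_trans (size_polyD _ _) _; rewrite geq_max hm.
have hTmd : (T m)`_d = q`_d.
  have hs : (shift_diff 1 m)`_d = 0 by rewrite nth_default // size_shift_diff.
  have hd : m`_d = q`_d / (d + k.+1)%:R by rewrite coefZ coefXn eqxx mulr1.
  rewrite 2!coefD coef_shift_diff // coefZ [(m + _)`_d]coefD hs hd.
  rewrite mul1r !addr0 -mulrDl -natrD mulrC divfK //.
  by rewrite pnatr_eq0 addnS.
have [|p hp] := IH (q - T m).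
  rewrite ltnS; apply/leq_sizeP => j; rewrite leq_eqVlt => /orP[/eqP <-|hj].
    by rewrite coefB hTmd subrr.
  by rewrite coefB !nth_default ?subrr // (leq_trans _ hj).
by exists (p + m); rewrite TE TD -(TE p) hp subrK.
Qed.

(** Horner induction: if p >= e > 0 at n, then n p(n) + c >= n e - |c|, which exceeds 1 once n > (1
    + |c|) / e. Mere positivity of p(n) would not carry the induction, hence the uniform bound e. *)
Lemma lead_coef_gt0_eventually (R : archiRealFieldType) (p : {poly R}) :
  0 < lead_coef p ->
  exists N : nat, exists2 e : R, 0 < e &
    forall n : nat, (N <= n)%N -> e <= p.[n%:R].
Proof.
elim/poly_ind: p => [|p c IH]; first by rewrite lead_coef0 ltxx.
have [->|p0] := eqVneq p 0.
  rewrite mul0r add0r lead_coefC => c0.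
  by exists 0%N, c => // n _; rewrite hornerC.
rewrite lead_coefDl ?lead_coefMX; last first.
  rewrite size_mulX // (leq_ltn_trans (size_polyC_leq1 c)) //.
  by rewrite ltnS size_poly_gt0.
move=> /IH [N [e e0 he]].
exists (maxn N (Num.bound ((1 + `|c|) / e))), 1 => // n.
rewrite geq_max => /andP[/he hn hb].
have : (1 + `|c|) / e < n%:R.
  apply: lt_le_trans (archi_boundP _) _; last by rewrite ler_nat.
  by rewrite divr_ge0 ?addr_ge0 // ltW.
rewrite ltr_pdivrMr // => hn2; rewrite hornerMXaddC.
have h1 : n%:R * e <= p.[n%:R] * n%:R by rewrite mulrC ler_wpM2r.
have h2 : - c <= `|c| by rewrite -normrN ler_norm.
by lra.
Qed.

Lemma shift_log_concave_eventually (R : archiRealFieldType) (p : {poly R})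
    (k : nat) : (0 < k)%N ->
  exists N : nat, forall n : nat, (N <= n)%N ->
    n%:R * (n + k).+1%:R * (p.[n.+1%:R] * p.[n%:R - 1])
      <= n.+1%:R * (n + k)%:R * p.[n%:R] ^+ 2.
Proof.
move=> k0; have [->|p0] := eqVneq p 0.
  by exists 0%N => n _; rewrite !horner0 !mulr0 expr0n /= mulr0.
pose d := (size p).-1; pose a := lead_coef p.
(* Q is the difference of the two sides, written with factors of degree at most
   d: multiplying a difference by 'X restores the degree, and X2w is 'X^2 times
   the shift difference of w. *)
have a0 : a != 0 by rewrite lead_coef_eq0.
have hp : (size p <= d.+1)%N by apply: leqSpred.
pose u := shift_diff 1 p; pose w := shift_diff (-1) p.
pose Xu := 'X * u; pose Xw := 'X * w.
pose X2w := 'X * shift_diff 1 Xw - Xw - 'X * shift_diff 1 w.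
pose Q := k%:R *: (p * p) + p * X2w - Xu * Xw
  + k.+1%:R *: (p * ('X * shift_diff 1 w) - Xu * w).
have hw : (size w <= d)%N by apply: size_shift_diff.
have hw' : (size w <= d.+1)%N by apply: leqW.
have hXu : (size Xu <= d.+1)%N by apply: size_X_shift_diff.
have hXw : (size Xw <= d.+1)%N by apply: size_X_shift_diff.
have hX1 : (size ('X * shift_diff 1 w)%R <= d.+1)%N by apply: size_X_shift_diff.
have hX2 : (size ('X * shift_diff 1 Xw)%R <= d.+1)%N by apply: size_X_shift_diff.
have hX2w : (size X2w <= d.+1)%N.
  apply: leq_trans (size_polyD _ _) _; rewrite geq_max size_polyN hX1 andbT.
  by apply: leq_trans (size_polyD _ _) _; rewrite geq_max size_polyN hX2.
have wd : w`_d = 0 by rewrite nth_default.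
have Xud : Xu`_d = d%:R * a by rewrite coef_shift_diff // mul1r.
have Xwd : Xw`_d = - (d%:R * a) by rewrite coef_shift_diff // mulN1r mulNr.
have X1d : ('X * shift_diff 1 w)`_d = 0 by rewrite coef_shift_diff // wd mulr0.
have X2d : X2w`_d = d%:R * a - d%:R ^+ 2 * a.
  by rewrite !coefB X1d Xwd coef_shift_diff // Xwd; ring.
have hQ : (size Q <= (d + d).+1)%N.
  apply/leq_sizeP => j hj.
  have hM (q r : {poly R}) : (size q <= d.+1)%N -> (size r <= d.+1)%N -> (q * r)`_j = 0.
    by move=> hq hr; rewrite nth_default // (leq_trans (size_mul_le hq hr)).
  by rewrite coefD coefB coefD !coefZ coefB !hM // !(mulr0, subr0, addr0).
(* The terms in d^2 a^2 coming from [p * X2w] and [- Xu * Xw] cancel. What remains is positive even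
   for constant p, because k > 0. *)
have Qd : Q`_(d + d) = (k%:R + d%:R) * a ^+ 2.
  rewrite coefD coefB coefD !coefZ coefB !coef_mul_le // X1d wd X2d Xud Xwd.
  by rewrite -/a -[p`_d]/a; ring.
have Qpos : 0 < Q`_(d + d).
  rewrite Qd mulr_gt0 ?exprn_even_gt0 ?a0 // -natrD ltr0n addn_gt0 k0 //.
have Qlead : 0 < lead_coef Q.
  suff hs : size Q = (d + d).+1 by rewrite /lead_coef hs.
  apply/eqP; rewrite eqn_leq hQ /= ltnNge; apply/negP => hs.
  by move: Qpos; rewrite nth_default ?ltxx.
have [N [e e0 hN]] := lead_coef_gt0_eventually Qlead.
exists N => n /hN hn; rewrite -subr_ge0.
suff -> : n.+1%:R * (n + k)%:R * p.[n%:R] ^+ 2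
    - n%:R * (n + k).+1%:R * (p.[n.+1%:R] * p.[n%:R - 1]) = Q.[n%:R].
  by lra.
rewrite /Q /X2w /Xu /Xw /u /w /shift_diff.
rewrite !(hornerE, horner_comp) /= addrK.
by rewrite -!natr1 !natrD; ring.
Qed.

End Asymptotics.

(** * The numbers c_k(j): recurrence, polynomiality in j, and skew log-concavity *)

Section ScaledCoef.
Set Implicit Arguments.
Unset Strict Implicit.
Variable g : nat -> int.

Lemma size_dArcais n : (size (dArcais g n) <= n.+1)%N.
Proof.
elim/ltn_ind: n => -[|n] IH; first by rewrite dArcais0 size_poly1.
rewrite dArcaisE //; apply: leq_trans (size_polyMleq _ _) _.
have hX : (size ((n.+1%:R^-1 : rat) *: 'X)%R <= 2)%N.
  by apply: leq_trans (size_scale_leq _ _) _; rewrite size_polyX.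
set S := \sum_(_ <= _ < _) _.
suff hS : (size S <= n.+1)%N by rewrite -subn1 leq_subLR; apply: leq_add hX hS.
rewrite /S big_add1 big_mkord; apply: leq_trans (size_sum _ _ _) _.
apply/bigmax_leqP => i _; apply: leq_trans (size_scale_leq _ _) _.
by rewrite subSS (leq_trans (IH _ _)) // ltnS leq_subr.
Qed.

Lemma coef_dArcaisS n j :
  n.+1%:R * (dArcais g n.+1)`_j.+1
    = \sum_(i < n.+1) (g i.+1)%:~R * (dArcais g (n - i))`_j.
Proof.
rewrite dArcaisE // -scalerAl coefZ mulrA divff ?pnatr_eq0 // mul1r coefXM /=.
rewrite big_add1 big_mkord coef_sum; apply: eq_bigr => i _.
by rewrite coefZ subSS.
Qed.

(* With G(q) = \sum_m g(m) q^m / m, this is the coefficient of q^(j+k) in G^j. *)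
Definition scaled_coef k j : rat := j`!%:R * (dArcais g (j + k))`_j.

Lemma scaled_coefk0 k : scaled_coef k 0 = (k == 0%N)%:R.
Proof.
rewrite /scaled_coef add0n mul1r; case: k => [|k]; first by rewrite coef1.
by rewrite dArcaisE // -scalerAl coefZ coefXM mulr0.
Qed.

Lemma scaled_coefS k j :
  (j.+1 + k)%:R * scaled_coef k j.+1
    = j.+1%:R * \sum_(i < k.+1) (g i.+1)%:~R * scaled_coef (k - i) j.
Proof.
rewrite /scaled_coef mulrCA addSn coef_dArcaisS factS natrM -mulrA; congr (_ * _).
rewrite mulr_sumr.
rewrite -(big_mkord xpredT
            (fun i => j`!%:R * ((g i.+1)%:~R * (dArcais g (j + k - i))`_j))).
(* For i > k the polynomial P_(j+k-i) has degree below j, so the sum stops at i = k. *)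
rewrite (big_cat_nat (n := k.+1)) ?ltnS ?leq_addl //= [X in _ + X]big1_seq ?addr0.
  rewrite big_mkord; apply: eq_bigr => i _.
  by rewrite mulrCA addnBA // -ltnS.
move=> i; rewrite mem_index_iota => /= /andP[hki hij].
rewrite [_`_j]nth_default ?mulr0 // (leq_trans (size_dArcais _)) //.
by lia.
Qed.

Hypothesis g1 : g 1%N = 1.

Lemma scaled_coef0j j : scaled_coef 0 j = 1.
Proof.
elim: j => [|j IH]; first by rewrite scaled_coefk0.
have j0 : j.+1%:R != 0 :> rat by rewrite pnatr_eq0.
apply: (mulfI j0).
by have := scaled_coefS 0 j; rewrite addn0 big_ord1 subn0 IH g1 mul1r.
Qed.

(* The polynomial found for c_(k+1) takes the value c_(k+1)(0) = 0 at 0: this is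
   the equation [pE] at x = -1. *)
Lemma scaled_coef_poly k :
  exists p : {poly rat}, forall j, scaled_coef k j = p.[j%:R].
Proof.
(* The recurrence for one index involves all smaller ones, so the induction carries the whole family
   up to k. *)
suff [P hP] : exists P : nat -> {poly rat},
    forall i j, (i < k.+1)%N -> scaled_coef i j = (P i).[j%:R].
  by exists (P k) => j; apply: hP.
elim: k => [|k [P hP]].
  by exists (fun=> 1) => -[|i] j // _; rewrite scaled_coef0j hornerC.
(* [S] gathers the already known terms of the recurrence for c_(k+1); the remaining term, c_(k+1)(j)
   itself, moves to the left and gives the shift equation. *)
pose S : {poly rat} := \sum_(i < k.+1) (g i.+2)%:~R *: P (k - i)%N.
have SE j : S.[j%:R]
    = \sum_(i < k.+1) (g i.+2)%:~R * scaled_coef (k - i) j.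
  rewrite horner_sum; apply: eq_bigr => i _.
  by rewrite hornerZ hP // ltnS leq_subr.
have [p hp] := shift_equation_surj k (('X + 1%:P) * S).
have pE x : (x + k.+2%:R) * p.[x + 1] - (x + 1) * p.[x] = (x + 1) * S.[x].
  have := congr1 (horner^~ x) hp.
  by rewrite !(hornerE, horner_comp).
exists (fun i => if (i <= k)%N then P i else p) => i j.
rewrite ltnS leq_eqVlt => /orP[/eqP -> {i}|hi]; last first.
  by rewrite -ltnS hi; apply: hP.
rewrite ltnn; elim: j => [|j IH].
  have := pE (-1); rewrite addNr !mul0r subr0 scaled_coefk0 => /eqP.
  rewrite -[k.+2%:R]natr1 addrC addrK mulf_eq0 pnatr_eq0 /= => /eqP hp0.
  by rewrite hp0.
have j0 : (j.+1 + k.+1)%:R != 0 :> rat by rewrite pnatr_eq0.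
apply: (mulfI j0).
rewrite scaled_coefS big_ord_recl subn0 g1 mul1r IH mulrDr.
under eq_bigr => i _ do rewrite lift0 subSS.
rewrite -SE.
have := pE j%:R; rewrite natr1 -natrD addnS addSn => /eqP.
by rewrite subr_eq addrC => /eqP ->.
Qed.

(** With j = n - k, the coefficients are c_k(j) / j! for P_n and n! c_k(j) / j! for A_n; clearing
    factorials turns the condition for A_n into the last hypothesis. *)
Lemma skewly_log_concave_scaled_coef k n : (k < n)%N ->
    0 <= scaled_coef k (n - k).+1 * scaled_coef k (n - k).-1 ->
    (n - k)%:R * n.+1%:R * (scaled_coef k (n - k).+1 * scaled_coef k (n - k).-1)
      <= (n - k).+1%:R * n%:R * scaled_coef k (n - k) ^+ 2 ->
  skewly_log_concave (dArcais_fact g) k n /\ skewly_log_concave (dArcais g) k n.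
Proof.
move=> hkn; have [i ->] : exists i, n = (i.+1 + k)%N.
  by exists (n - k.+1)%N; rewrite addSnnS subnK.
rewrite /skewly_log_concave /dArcais_fact !coefZ -addSn addSn /= -addSn !addnK.
rewrite addSn ltnS leq_addl -!addSn.
have coefE j : (dArcais g (j + k))`_j = scaled_coef k j / j`!%:R.
  by rewrite /scaled_coef mulrC mulKf // pnatr_eq0 -lt0n fact_gt0.
rewrite !coefE !(addSn, factS, natrM) /=.
move: (scaled_coef k i.+2) (scaled_coef k i) (scaled_coef k i.+1) => x y z xy h.
have [fi fn] : 0 < i`!%:R :> rat /\ 0 < (i + k)`!%:R :> rat.
  by rewrite !ltr0n !fact_gt0.
have [a0 b0] : 0 < i.+1%:R :> rat /\ 0 < i.+2%:R :> rat by rewrite !ltr0n.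
have m0 : 0 < (i + k).+1%:R :> rat by rewrite ltr0n.
have mm : (i + k).+1%:R <= (i + k).+2%:R :> rat by rewrite ler_nat.
move: mm fi fn a0 b0 m0 h.
move: (i`!%:R : rat) ((i + k)`!%:R : rat) (i.+1%:R : rat) (i.+2%:R : rat) => I F a b.
move: ((i + k).+1%:R : rat) ((i + k).+2%:R : rat) => m m' mm I0 F0 a0 b0 m0 h.
have ne := (gt_eqF I0, gt_eqF a0, gt_eqF b0, gt_eqF m0).
split; split => //.
  have K0 : 0 <= F ^+ 2 * m / (I ^+ 2 * a ^+ 2 * b).
    by rewrite divr_ge0 ?mulr_ge0 ?(ltW F0) ?(ltW I0) ?(ltW a0) ?(ltW b0) ?(ltW m0).
  have := ler_wpM2l K0 h; congr (_ <= _); field; rewrite ?ne //.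
have K0 : 0 <= (I ^+ 2 * a ^+ 2 * b * m)^-1.
  by rewrite invr_ge0 !mulr_ge0 ?(ltW F0) ?(ltW I0) ?(ltW a0) ?(ltW b0) ?(ltW m0).
(* Since x y >= 0, replacing n + 1 by n on the left weakens the inequality; after division by n it
   is the condition for P_n. *)
have h' : a * m * (x * y) <= b * m * z ^+ 2.
  by apply: le_trans h; rewrite ler_wpM2r // ler_pM2l.
have := ler_wpM2l K0 h'; congr (_ <= _); field; rewrite ?ne //.
Qed.

Lemma skewly_log_concave_top n : (0 < n)%N ->
  skewly_log_concave (dArcais_fact g) 0 n /\ skewly_log_concave (dArcais g) 0 n.
Proof.
move=> n0; apply: skewly_log_concave_scaled_coef => //; rewrite subn0 !scaled_coef0j.
  by rewrite mulr1.
by rewrite expr1n !mulr1 mulrC.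
Qed.

Lemma scaled_coef_ge0 k j : (forall m, 0 <= g m) -> 0 <= scaled_coef k j.
Proof.
move=> g_ge0; elim: j k => [|j IH] k; first by rewrite scaled_coefk0.
have jk0 : 0 < (j.+1 + k)%:R :> rat by rewrite ltr0n.
rewrite -(pmulr_rge0 _ jk0) scaled_coefS mulr_ge0 // sumr_ge0 // => i _.
by rewrite mulr_ge0 ?ler0z.
Qed.

Lemma skewly_log_concave_eventually k : (forall m, 0 <= g m) ->
  exists n0 : nat, forall n, (n0 <= n)%N ->
    skewly_log_concave (dArcais_fact g) k n /\ skewly_log_concave (dArcais g) k n.
Proof.
(* For k = 0 the top coefficient (k + d) a^2 vanishes, as c_0 is constant; equality holds there
   instead. *)
move=> g_ge0; case: (posnP k) => [->|k0].
  by exists 1%N => n; apply: skewly_log_concave_top.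
have [p hp] := scaled_coef_poly k.
have [N hN] := shift_log_concave_eventually p k0.
(* This bound gives both n - k >= N and k < n; the latter makes the predecessor of n - k a true
   subtraction. *)
exists (N + k.+1)%N => n hn; have hkn := leq_trans (leq_addl N k.+1) hn.
apply: skewly_log_concave_scaled_coef => //.
  by rewrite mulr_ge0 ?scaled_coef_ge0.
have /hN : (N <= n - k)%N by lia.
have -> : (n - k)%:R - 1 = (n - k).-1%:R :> rat.
  by rewrite -{1}(prednK (n := n - k)) ?subn_gt0 // -natr1 addrK.
by rewrite subnK ?(ltnW hkn) // !hp.
Qed.

(** Here G(q) is a multiple of q, so G^j has no term q^(j+k) with k > 0. *)
Lemma scaled_coef_unit k j : (forall m, (1 < m)%N -> g m = 0) ->
  (0 < k)%N -> scaled_coef k j = 0.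
Proof.
move=> g0 k0; elim: j => [|j IH]; first by rewrite scaled_coefk0 gtn_eqF.
have jk0 : (j.+1 + k)%:R != 0 :> rat by rewrite pnatr_eq0.
apply: (mulfI jk0); rewrite scaled_coefS big_ord_recl subn0 IH mulr0 add0r.
by rewrite big1 ?mulr0 // => i _; rewrite g0 ?mul0r.
Qed.

End ScaledCoef.

Theorem theorem2p2 (g : nat -> nat) (g1 : g 1%N = 1%N) (k : nat) :
  let gz := fun m : nat => (g m)%:Z in
  ((exists kappa : nat,
      [/\ (2 <= kappa)%N, g kappa <> 0%N
        & forall m : nat, (2 <= m <= kappa.-1)%N -> g m = 0%N]) ->
   exists n0 : nat, forall n : nat, (n0 <= n)%N ->
     skewly_log_concave (dArcais_fact gz) k n /\
     skewly_log_concave (dArcais gz) k n)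
  /\
  ((forall m : nat, (1 <= m)%N -> g m = arith_unit m) ->
   forall l n : nat, (l.+1 <= n)%N ->
     skewly_log_concave (dArcais_fact gz) l n /\
     skewly_log_concave (dArcais gz) l n).
Proof.
move=> gz; have gz1 : gz 1%N = 1 by rewrite /gz g1.
split=> [_|gE l n hln]; first exact: skewly_log_concave_eventually.
have gz0 m : (1 < m)%N -> gz m = 0.
  by move=> m1; rewrite /gz gE ?(ltnW m1) // /arith_unit gtn_eqF.
case: l hln => [|l] hln; first exact: skewly_log_concave_top.
(* At a positive index every c_k(j) is 0, so both sides vanish. *)
apply: skewly_log_concave_scaled_coef => //; rewrite !scaled_coef_unit //.
by rewrite expr0n !mulr0.
Qed.
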